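(* Given $d\ge1$ and a metric space $X$ admitting a geometric tree-like decomposition $\{X_n\}_{n\in N}$, if there exist uniformly Lipschitz light maps $f_n:X_n\to\mathbb{R}^d$ ($n\in N$), then the Lipschitz dimension of $X$ satisfies $\dim_L(X)\le d$.
   Context: Tree-like decompositions. Let $N=\{0,1,\dots,\max(N)\}$ or $N=\mathbb{N}=\{0,1,2,\dots\}$. A family $\{X_n\}_{n\in N}$ of subsets of $X$ is a tree-like decomposition of $X$ if $X=\bigcup_{n\in N}X_n$ and, for each $n\in N\setminus\{0\}$, the set $X_n\cap\bigcup_{m<n}X_m$ consists of exactly one point $p_n$; the $p_n$ are called branch points. A decomposition path from $x$ to $y$ is a finite sequence $(z_i)_{i\in I}$, $I=\{0,\dots,\max(I)\}$, with $z_0=x$, $z_{\max(I)}=y$, with $z_i$ a branch point for $1\le i\le\max(I)-1$, and such that for each $1\le i\le\max(I)$ there is $n_i\in N$ with $\{z_{i-1},z_i\}\subset X_{n_i}$. It is minimal if there is no proper subset $I'\subsetneq I$ such that $(z_i)_{i\in I'}$ is a decomposition path from $z_0$ to $z_{\max(I)}$. For $C\ge1$, $\{X_n\}_{n\in N}$ is a $C$-geometric tree-like decomposition of the metric space $(X,\mathrm{dist})$ if (1) it is a tree-like decomposition; (2) for any minimal decomposition path $(z_i)_{i\in I}$, $\mathrm{dist}(z_0,z_{\max(I)})\le C\max_{i<\max(I)}\mathrm{dist}(z_i,z_{i+1})$; (3) for all $x,y\in X$ there is a decomposition path $(z_i)_{i\in I}$ from $x$ to $y$ with $C^{-1}\sum_{i<\max(I)}\mathrm{dist}(z_i,z_{i+1})\le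 \mathrm{dist}(x,y)$. It is geometric if it is $C$-geometric for some $C\ge 1$. For $\delta>0$, a finite sequence $(u_i)$ is a $\delta$-chain if consecutive points are at distance at most $\delta$. A set $U$ is $\delta$-connected if every pair of points of $U$ is contained in a $\delta$-chain in $U$; a $\delta$-component of a set is a maximal $\delta$-connected subset. A map $f:X\to Y$ is $L$-Lipschitz and $Q$-light ($L,Q>0$) if it is $L$-Lipschitz and for every $r>0$ and $E\subset Y$ with $\operatorname{diam}(E)\le r$, the $r$-components of $f^{-1}(E)$ have diameter at most $Qr$; it is Lipschitz light if this holds for some $L,Q>0$. Maps $f_n$ are uniformly Lipschitz light if the same $L,Q$ work for all $n$. $\dim_L(X)\le n$ means that there exists a Lipschitz light map $X\to\mathbb{R}^n$. *)

(* Defs.v *)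
From HB Require Import structures.
From mathcomp Require Import all_boot all_order all_algebra.
From mathcomp Require Import all_classical all_reals ereal topology.
From mathcomp Require Import ring.

Set Implicit Arguments.
Unset Strict Implicit.
Unset Printing Implicit Defensive.

Import Order.TTheory GRing.Theory Num.Theory.

Local Open Scope classical_set_scope.
Local Open Scope ring_scope.

(* A copy of 'rV[R]_n, which by itself carries the sup norm. *)
Definition euclidean (R : realType) (n : nat) : Type := 'rV[R]_n.

Section EuclideanMetric.
Variables (R : realType) (n : nat).
Implicit Types x y z : 'rV[R]_n.

Definition euclidean_dist x y : R :=
  Num.sqrt (\sum_(i < n) (x 0 i - y 0 i) ^+ 2).

Lemma euclidean_distxx x : euclidean_dist x x = 0.
Proof.
rewrite /euclidean_dist big1 ?sqrtr0// => i _.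
by rewrite subrr expr0n.
Qed.

Lemma euclidean_dist_positivity x y : euclidean_dist x y = 0 -> x = y.
Proof.
move/eqP; rewrite sqrtr_eq0 => s0; apply/rowP => i.
apply/eqP; rewrite -subr_eq0 -sqrf_eq0 eq_le sqr_ge0 andbT.
apply: le_trans s0; rewrite (bigD1 i)//= lerDl.
by apply: sumr_ge0 => j _; exact: sqr_ge0.
Qed.

Lemma euclidean_dist_sym x y : euclidean_dist x y = euclidean_dist y x.
Proof.
by congr Num.sqrt; apply: eq_bigr => i _; rewrite -sqrrN opprB.
Qed.

Lemma cauchy_schwarz_sum (a b : 'I_n -> R) :
  (\sum_i a i * b i) ^+ 2 <= (\sum_i a i ^+ 2) * (\sum_i b i ^+ 2).
Proof.
set S := \sum_i a i * b i; set A := \sum_i a i ^+ 2; set B := \sum_i b i ^+ 2.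
have B0 : 0 <= B by apply: sumr_ge0 => i _; exact: sqr_ge0.
have [B_gt0|] := ltP 0 B; last first.
  move=> Ble0; have b0 i : b i = 0.
    apply/eqP; rewrite -sqrf_eq0 eq_le sqr_ge0 andbT.
    apply: le_trans Ble0; rewrite /B (bigD1 i)//= lerDl.
    by apply: sumr_ge0 => j _; exact: sqr_ge0.
  rewrite /S big1 => [|i _]; last by rewrite b0 mulr0.
  by rewrite expr0n mulr_ge0//; apply: sumr_ge0 => i _; exact: sqr_ge0.
rewrite -subr_ge0 -(pmulr_rge0 _ B_gt0).
have -> : B * (A * B - S ^+ 2) = \sum_i (B * a i - S * b i) ^+ 2.
  transitivity (\sum_i (B ^+ 2 * a i ^+ 2 - 2 * B * S * (a i * b i) +
                        S ^+ 2 * b i ^+ 2)); last first.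
    by apply: eq_bigr => i _; ring.
  by rewrite big_split/= sumrB -!mulr_sumr -/A -/B -/S; ring.
by apply: sumr_ge0 => i _; exact: sqr_ge0.
Qed.

Lemma euclidean_dist_triangle y x z :
  euclidean_dist x z <= euclidean_dist x y + euclidean_dist y z.
Proof.
rewrite /euclidean_dist.
set A := \sum_i (x 0 i - y 0 i) ^+ 2; set B := \sum_i (y 0 i - z 0 i) ^+ 2.
have A0 : 0 <= A by apply: sumr_ge0 => i _; exact: sqr_ge0.
have B0 : 0 <= B by apply: sumr_ge0 => i _; exact: sqr_ge0.
rewrite -(@ler_pXn2r _ 2%N)// ?nnegrE ?addr_ge0 ?sqrtr_ge0//.
rewrite sqrrD !sqr_sqrtr//; last by apply: sumr_ge0 => i _; exact: sqr_ge0.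
rewrite -sqrtrM//.
set S := \sum_i (x 0 i - y 0 i) * (y 0 i - z 0 i).
have -> : \sum_i (x 0 i - z 0 i) ^+ 2 = A + S *+ 2 + B.
  rewrite /A /S /B -sumrMnl -!big_split/=.
  by apply: eq_bigr => i _; ring.
rewrite lerD2r lerD2l lerMn2r/=.
apply: le_trans (ler_norm _) _; rewrite -sqrtr_sqr.
by apply: ler_wsqrtr; exact: cauchy_schwarz_sum.
Qed.

HB.instance Definition _ := Choice.on (euclidean R n).
HB.instance Definition _ := @isMetric.Build R (euclidean R n)
  euclidean_dist euclidean_distxx euclidean_dist_positivity
  euclidean_dist_sym euclidean_dist_triangle.

End EuclideanMetric.

Section DeltaComponents.
Variables (R : realType) (T : metricType R).

(* The maximum with 0 makes the diameter of the empty set equal to 0. *)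
Definition diam (A : set T) : \bar R :=
  Order.max 0%E (ereal_sup [set (mdist p.1 p.2)%:E | p in A `*` A]).

Definition delta_chain (delta : R) (c : seq T) : bool :=
  sorted (fun u v => mdist u v <= delta) c.

Definition delta_connected (delta : R) (A : set T) : Prop :=
  forall x y, A x -> A y ->
    exists c : seq T, [/\ delta_chain delta c, [set` c] `<=` A,
                          x \in c & y \in c].

Definition delta_component (delta : R) (A K : set T) : Prop :=
  [/\ K `<=` A, delta_connected delta K &
      forall K', K' `<=` A -> delta_connected delta K' ->
        K `<=` K' -> K' = K].

End DeltaComponents.

Section LipschitzLightMaps.
Variables (R : realType) (T U : metricType R).

(* The map A -> U is the restriction to A, with the induced metric, of a
   function on T whose values outside A are irrelevant. *)
Definition lipschitz_light_on (L Q : R) (A : set T) (f : T -> U) : Prop :=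
  [/\ 0 < L, 0 < Q,
      forall x y, A x -> A y -> mdist (f x) (f y) <= L * mdist x y &
      forall (r : R) (E : set U), 0 < r -> (diam E <= r%:E)%E ->
        forall K, delta_component r (A `&` f @^-1` E) K ->
          (diam K <= (Q * r)%:E)%E].

Definition lipschitz_light (f : T -> U) : Prop :=
  exists L Q : R, lipschitz_light_on L Q [set: T] f.

End LipschitzLightMaps.

Definition lipschitz_dim_le (R : realType) (T : metricType R) (n : nat) : Prop :=
  exists f : T -> euclidean R n, lipschitz_light f.

(* `I_m.+1 is {0, ..., m}. *)
Definition index_set (N : set nat) : Prop :=
  N = [set: nat] \/ exists m : nat, N = `I_m.+1.

Section TreeLikeDecomposition.
Variables (R : realType) (T : metricType R).
(* Only the X n with n in N matter. *)
Variables (N : set nat) (X : nat -> set T).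

Definition branch_point (p : T) : Prop :=
  exists n : nat,
    [/\ N n, n != 0%N & X n `&` \bigcup_(m < n) X m = [set p]].

Definition tree_like_decomposition : Prop :=
  [/\ index_set N, \bigcup_(n in N) X n = [set: T] &
      forall n, N n -> n != 0%N ->
        exists p, X n `&` \bigcup_(m < n) X m = [set p]].

(* The sequence (z_i), 0 <= i <= max I, is a list of length max I + 1. *)
Definition decomposition_path (x y : T) (z : seq T) : Prop :=
  [/\ (0 < size z)%N,
      nth x z 0 = x,
      nth x z (size z).-1 = y,
      forall i, (1 <= i)%N -> (i < (size z).-1)%N -> branch_point (nth x z i) &
      forall i, (1 <= i)%N -> (i <= (size z).-1)%N ->
        exists n, [/\ N n, X n (nth x z i.-1) & X n (nth x z i)]].

(* The families (z_i), i in I', with I' a proper subset of I, are the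
   subsequences of z of strictly smaller length. *)
Definition minimal_decomposition_path (x y : T) (z : seq T) : Prop :=
  decomposition_path x y z /\
  forall z' : seq T, subseq z' z -> (size z' < size z)%N ->
    ~ decomposition_path x y z'.

(* For a one-point path the maximum below is over the empty set, and is 0. *)
Definition C_geometric (C : R) : Prop :=
  [/\ tree_like_decomposition,
      forall x y z, minimal_decomposition_path x y z ->
        mdist x y <=
          C * \big[Num.max/0]_(i < (size z).-1) mdist (nth x z i) (nth x z i.+1) &
      forall x y, exists2 z, decomposition_path x y z &
        C^-1 * \sum_(i < (size z).-1) mdist (nth x z i) (nth x z i.+1)
          <= mdist x y].

Definition geometric : Prop := exists2 C : R, 1 <= C & C_geometric C.

End TreeLikeDecomposition.

(* Main.v *)
Require Import Defs.
From mathcomp Require Import all_boot all_order all_algebra.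
From mathcomp Require Import all_classical all_reals ereal topology.
From mathcomp Require Import zify lra.

Set Implicit Arguments.
Unset Strict Implicit.
Unset Printing Implicit Defensive.

Import Order.TTheory GRing.Theory Num.Theory.

(** The map is obtained by gluing the [f n] by translations. On [X 0] it is
    [f 0], and on [X n] it is [f n] translated so as to agree, at the single
    point [p n] where [X n] meets the earlier pieces, with what is already
    defined ([tree_like_recursion]). On each piece the glued map [g] is still
    [L]-Lipschitz and [Q]-light, and it is [L * C]-Lipschitz on the whole space
    because any two points are joined by a decomposition path of length at most
    [C] times their distance ([glued_lipschitz]).

    For lightness, let [diam E <= r] and let [x] and [y] be joined by an
    [r]-chain in the preimage of [E]. Join consecutive points of the chain by
    such short decomposition paths: this gives a chain from [x] to [y] with steps of
    length at most [C * r], each inside one piece, which stays in the preimage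
    of a set [E'] of diameter at most a multiple of [r] ([refine_chain]). Now
    take a shortest decomposition path [z] from [x] to [y], two consecutive
    points of which lie in a piece [X n], and apply to the refined chain the
    retraction onto [X n] that collapses the other pieces. A step of the chain
    is either unchanged (if it lies in [X n]) or collapsed to a point, so what
    remains is a chain in [X n] with the same bounds ([chained_retraction]);
    since [z] is shortest, its ends are exactly the two consecutive points of
    [z] ([shortest_path_retraction]). Lightness of [g] on [X n] bounds their
    distance by a multiple of [r]. Thus all steps of [z] are short, and
    in a geometric decomposition the ends of a minimal path are at distance at
    most [C] times its longest step.

    This last condition is what prevents translations from folding the tree: it
    fails for a half-line cut into unit intervals, which alternating
    orientations of the pieces would map into a bounded interval. *)

Local Open Scope classical_set_scope.
Local Open Scope ring_scope.

(** * Chains inside a set *)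

Inductive chained (T : Type) (e : T -> T -> Prop) (A : set T) :
    T -> T -> Prop :=
| chained_refl x : A x -> chained e A x x
| chained_step x y z : A x -> e x y -> chained e A y z -> chained e A x z.

Section Chained.
Variables (T : Type) (e : T -> T -> Prop).
Implicit Types (A B : set T) (x y z : T).

Lemma chained_endpoints A x y : chained e A x y -> A x /\ A y.
Proof. by elim=> // {}x z {}y Ax _ _ []. Qed.

Lemma chained_trans A y x z :
  chained e A x y -> chained e A y z -> chained e A x z.
Proof.
by elim=> // {}x y' {}y Ax exy _ IH /IH; exact: chained_step.
Qed.

Lemma chained_sym A x y : (forall u v, e u v -> e v u) ->
  chained e A x y -> chained e A y x.
Proof.
move=> esym; elim=> [u Au|u v w Au euv vw wv]; first exact: chained_refl.
have [Av _] := chained_endpoints vw.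
apply: (chained_trans wv); apply: (chained_step Av (esym _ _ euv)).
exact: chained_refl.
Qed.

Lemma sub_chained A B (e' : T -> T -> Prop) x y : A `<=` B ->
  (forall u v, e u v -> e' u v) -> chained e A x y -> chained e' B x y.
Proof.
move=> AB ee'; elim=> [u /AB|u v w /AB Bu /ee' euv _].
  exact: chained_refl.
exact: chained_step.
Qed.

Lemma chained_seq A (w : nat -> T) k : (forall i, (i <= k)%N -> A (w i)) ->
  (forall i, (i < k)%N -> e (w i) (w i.+1)) -> chained e A (w 0) (w k).
Proof.
elim: k => [|k IH] Aw ew; first exact/chained_refl/Aw.
apply: (@chained_trans _ (w k)).
  by apply: IH => i ik; [apply: Aw; lia|apply: ew; lia].
apply: chained_step (ew k _) _ => //; first exact: Aw.
exact/chained_refl/Aw.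
Qed.

End Chained.

(** * Chains and components in a metric space *)

Section DeltaChains.
Variables (R : realType) (T : metricType R).
Implicit Types (A E : set T) (x y : T) (r : R).

Definition dist_le r x y := mdist x y <= r.

Lemma dist_le_sym r x y : dist_le r x y -> dist_le r y x.
Proof. by rewrite /dist_le metric_sym. Qed.

Lemma delta_chain_chained r A (c : seq T) x y : delta_chain r c ->
  [set` c] `<=` A -> x \in c -> y \in c -> chained (dist_le r) A x y.
Proof.
case: c => [//|h c] hc cA xc yc.
suff from_head v : v \in h :: c -> chained (dist_le r) A h v.
  apply: chained_trans (from_head _ yc).
  by apply/chained_sym/from_head => //; exact: dist_le_sym.
elim: c h hc cA {xc yc} => [|h' c IH] h /=.
  by move=> _ cA; rewrite inE => /eqP ->; apply/chained_refl/cA; rewrite /= inE.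
move=> /andP[hh' h'c] cA; rewrite inE => /predU1P[->|vc].
  by apply/chained_refl/cA; rewrite /= inE eqxx.
apply: (@chained_step _ _ _ _ h') => //.
  by apply: cA; rewrite /= inE eqxx.
apply: IH => // u /= uc; apply: cA => /=.
by rewrite inE uc orbT.
Qed.

Lemma chained_delta_chain r A x y : chained (dist_le r) A x y ->
  exists c : seq T, [/\ delta_chain r c, [set` c] `<=` chained (dist_le r) A x,
    x \in c & y \in c].
Proof.
move=> xy.
suff [s [rs ls sA]] : exists s, [/\ path (fun u v => mdist u v <= r) x s,
    last x s = y & [set` x :: s] `<=` chained (dist_le r) A x].
  exists (x :: s); split=> //; first by rewrite inE eqxx.
  by rewrite -ls mem_last.
elim: xy => [u Au|u v w Au uv vw [s [rs ls sA]]].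
  exists [::]; split=> // v /=; rewrite inE => /eqP ->.
  exact: chained_refl.
exists (v :: s); split=> //=; first by rewrite rs andbT.
move=> t /=; rewrite inE => /predU1P[->|ts]; first exact: chained_refl.
by apply: (chained_step Au uv); exact: sA.
Qed.

(** Components are the classes of the relation of being joined by a chain; this
    turns bounds on the diameters of components into bounds on the distance
    between the ends of a chain, and conversely. *)
Lemma chained_delta_component r A x : A x ->
  delta_component r A (chained (dist_le r) A x).
Proof.
move=> Ax; split.
- by move=> y xy; have [] := chained_endpoints xy.
- move=> y z xy xz.
  have yz : chained (dist_le r) A y z.
    by apply: chained_trans xz; apply: chained_sym xy; exact: dist_le_sym.
  have [c [rc cA yc zc]] := chained_delta_chain yz.
  by exists c; split=> // t /cA; exact: chained_trans.
- move=> K KA Kconn xK; apply/seteqP; split=> // y Ky.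
  have [c [rc cK xc yc]] := Kconn _ _ (xK _ (chained_refl _ Ax)) Ky.
  by apply: delta_chain_chained rc _ xc yc => t /cK /KA.
Qed.

Lemma diam_le A r : 0 <= r -> (forall x y, A x -> A y -> mdist x y <= r) ->
  (diam A <= r%:E)%E.
Proof.
move=> r0 Ar; rewrite /diam ge_max lee_fin r0 /=.
apply: ge_ereal_sup => _ [[x y] [/= Ax Ay] <-].
by rewrite lee_fin; exact: Ar.
Qed.

Lemma mdist_le_diam A r x y : (diam A <= r%:E)%E -> A x -> A y ->
  mdist x y <= r.
Proof.
rewrite /diam ge_max => /andP[_ Ar] Ax Ay.
rewrite -lee_fin; apply: le_trans Ar.
by apply: ereal_sup_ubound; exists (x, y).
Qed.

Lemma mdist_le_sum (w : nat -> T) k :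
  mdist (w 0) (w k) <= \sum_(i < k) mdist (w i) (w i.+1).
Proof.
elim: k => [|k IH]; first by rewrite mdistxx big_ord0.
rewrite big_ord_recr /=; apply: le_trans (metric_triangle _ (w k) _) _.
by rewrite lerD2r.
Qed.

End DeltaChains.

(** * Lipschitz light maps in terms of chains *)

Section LightMaps.
Variables (R : realType) (T U : metricType R).
Implicit Types (A : set T) (E : set U) (f : T -> U).

Lemma lipschitz_light_onP (L Q : R) A f :
  lipschitz_light_on L Q A f <->
  [/\ 0 < L, 0 < Q,
      forall x y, A x -> A y -> mdist (f x) (f y) <= L * mdist x y &
      forall (r : R) E, 0 < r -> (diam E <= r%:E)%E ->
        forall x y, chained (dist_le r) (A `&` f @^-1` E) x y ->
          mdist x y <= Q * r].
Proof.
split=> -[L0 Q0 fL fQ]; split=> //= r E r0 Er.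
  move=> x y xy; have [Ax _] := chained_endpoints xy.
  have := fQ _ _ r0 Er _ (chained_delta_component r Ax).
  by move=> /mdist_le_diam; apply=> //; exact: chained_refl.
move=> K [KA Kconn _]; apply: diam_le => [|x y Kx Ky].
  by rewrite mulr_ge0// ltW.
have [c [rc cK xc yc]] := Kconn _ _ Kx Ky.
apply: fQ r0 Er _ _ _; apply: delta_chain_chained rc _ xc yc.
by move=> t /cK /KA.
Qed.

Lemma lipschitz_light_on_isometry (L Q : R) A f g (phi : U -> U) :
  (forall u v, mdist (phi u) (phi v) = mdist u v) ->
  (forall x, A x -> g x = phi (f x)) ->
  lipschitz_light_on L Q A f -> lipschitz_light_on L Q A g.
Proof.
move=> phiI gE [L0 Q0 fL fQ]; split=> // [x y Ax Ay|r E r0 Er].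
  by rewrite !gE// phiI; exact: fL.
have -> : A `&` g @^-1` E = A `&` f @^-1` (phi @^-1` E).
  by apply/seteqP; split=> x /= [Ax]; rewrite gE.
apply: fQ => //; apply: diam_le (ltW r0) _ => u v Eu Ev.
by rewrite -phiI; exact: mdist_le_diam Er Eu Ev.
Qed.

End LightMaps.

(** * Tree-like decompositions *)

Section TreeLike.
Variables (R : realType) (T : metricType R) (N : set nat) (X : nat -> set T).
Hypothesis X_tree : tree_like_decomposition N X.

Definition same_piece x y : Prop := exists n, [/\ N n, X n x & X n y].

(** A model of the nearest-point projection onto [X n] in a tree: every other
    piece hangs off [X n] through a single point, to which it is collapsed. *)
Definition piece_retraction n (rho : T -> T) : Prop :=
  (forall x, X n x -> rho x = x) /\
  forall m x y, N m -> m != n -> X m x -> X m y -> rho x = rho y.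

Lemma index_set_closed m n : N n -> (m <= n)%N -> N m.
Proof.
have [[->|[k ->]] _ _] := X_tree => //= nk mn; exact: leq_ltn_trans mn nk.
Qed.

Lemma index_set0 : N 0.
Proof. by have [[->|[k ->]] _ _] := X_tree. Qed.

Lemma tree_like_cover x : exists2 n, N n & X n x.
Proof.
have [_ XT _] := X_tree; have : [set: T] x by [].
by rewrite -XT => -[n Nn Xnx]; exists n.
Qed.

Definition attaching_points (p : nat -> T) : Prop :=
  forall n, N n -> n != 0%N -> X n `&` \bigcup_(m < n) X m = [set p n].

Lemma exists_attaching_points (x0 : T) : exists p, attaching_points p.
Proof.
have [_ _ Xp] := X_tree.
have /choice[p pP] : forall n, exists q, N n -> n != 0%N ->
    X n `&` \bigcup_(m < n) X m = [set q].
  move=> n; have [[Nn n0]|H] := pselect (N n /\ n != 0%N).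
    by have [q Xq] := Xp n Nn n0; exists q.
  by exists x0 => Nn n0; case: H.
by exists p.
Qed.

Section AttachingPoints.
Variable p : nat -> T.
Hypothesis p_attaching : attaching_points p.

Lemma attaching_point_earlier n : N n -> n != 0%N ->
  exists2 m, (m < n)%N & X m (p n).
Proof.
move=> Nn n0; have [_ [m mn Xm]] : (X n `&` \bigcup_(m < n) X m) (p n).
  by rewrite p_attaching.
by exists m.
Qed.

Lemma attaching_point_unique m n x : N n -> (m < n)%N -> X m x -> X n x ->
  x = p n.
Proof.
move=> Nn mn Xm Xn; have n0 : n != 0%N by rewrite -lt0n; apply: leq_trans mn.
have : (X n `&` \bigcup_(m < n) X m) x by split=> //; exists m.
by rewrite p_attaching.
Qed.

(** Two pieces [X m] and [X n] with [m < n] meet at most in [p n], so a map can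
    be defined piece by piece, in the order of the indices, as soon as the
    prescription [h n y] on [X n] takes at [p n] the value [y] reached there
    before. Both the glued map and the retractions onto a piece arise so. *)
Lemma tree_like_recursion (Y : Type) (b : T -> Y) (h : nat -> Y -> T -> Y) :
  (forall n y, N n -> n != 0%N -> h n y (p n) = y) ->
  exists g : T -> Y, (forall x, X 0 x -> g x = b x) /\
    forall n x, N n -> n != 0%N -> X n x -> g x = h n (g (p n)) x.
Proof.
move=> hp; pose G := fix G n : T -> Y := if n is n'.+1 then
  fun x => if `[< X n x >] then h n (G n' (p n)) x else G n' x else b.
have GE m n x : N n -> (m <= n)%N -> X m x -> G n x = G m x.
  elim: n => [|n IH] Nn; first by rewrite leqn0 => /eqP ->.
  rewrite leq_eqVlt => /predU1P[-> //|mn Xm].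
  have Gm : G n x = G m x by apply: IH => //; exact: index_set_closed Nn _.
  rewrite -Gm /=; case: asboolP => // Xn.
  by rewrite (attaching_point_unique Nn mn Xm Xn) hp.
have /choice[i iP] : forall x, exists n, N n /\ X n x.
  by move=> x; have [n] := tree_like_cover x; exists n.
have gE n x : N n -> X n x -> G (i x) x = G n x.
  have [Ni Xi] := iP x; move=> Nn Xn.
  by case: (leqP (i x) n) => [/GE|/ltnW/GE] ->.
exists (fun x => G (i x) x); split=> [x /gE -> //|]; first exact: index_set0.
move=> n x Nn n0 Xn; rewrite (gE n)//; case: n n0 Nn Xn => // n _ Nn Xn /=.
case: asboolP => // _; have [m mn Xm] := attaching_point_earlier Nn isT.
have Nn' : N n by exact: index_set_closed Nn _.
by rewrite (gE m) ?(GE m n)//; exact: index_set_closed Nn' _.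
Qed.

(** Everything before [X n] is attached to it at [p n]. A later piece [X m] is
    attached at [p m], where the retraction is already known. *)
Lemma tree_like_retraction n : N n -> 
  exists rho : T -> T, piece_retraction n rho.
Proof.
move=> Nn.
pose b x := if n == 0%N then x else p n.
pose h m y x := if (m == n) && (x != p n) then x else y.
(* The case distinction at [p n] only makes the prescription on [X n] compatible
   with an arbitrary value [y]; the value reached at [p n] is [p n] itself. *)
have hp m y : N m -> m != 0%N -> h m y (p m) = y.
  by rewrite /h; case: (eqVneq m n) => [->|]//=; rewrite eqxx.
have [rho [rho0 rhoS]] := tree_like_recursion b hp; exists rho; split; last first.
  move=> m x y Nm mn Xx Xy; have [m0|m0] := eqVneq m 0%N.
    move: mn Xx Xy; rewrite m0 eq_sym => n0 /rho0 -> /rho0 ->.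
    by rewrite /b (negPf n0).
  by rewrite (rhoS m x)// (rhoS m y)// /h (negPf mn).
have [n0|n0] := eqVneq n 0%N.
  move=> x Xx; have X0x : X 0 x by rewrite -n0.
  by rewrite (rho0 _ X0x) /b n0.
have rho_before m x : (m < n)%N -> X m x -> rho x = p n.
  elim/ltn_ind: m x => m IH x mn Xm.
  have Nm : N m by exact: index_set_closed Nn (ltnW mn).
  have [m0|m0] := eqVneq m 0%N.
    have X0x : X 0 x by rewrite -m0.
    by rewrite (rho0 _ X0x) /b (negPf n0).
  rewrite (rhoS m)// /h (ltn_eqF mn) /=.
  have [k km Xk] := attaching_point_earlier Nm m0.
  exact: IH k km _ (ltn_trans km mn) Xk.
have rhop : rho (p n) = p n.
  by have [m mn Xm] := attaching_point_earlier Nn n0; exact: rho_before mn Xm.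
move=> x Xn; rewrite (rhoS n)// /h eqxx /= rhop.
by case: eqVneq.
Qed.

End AttachingPoints.

(** Steps in other pieces are collapsed by [rho], and steps in [X n] are fixed
    by it. The first alternative occurs if the whole chain is collapsed; then
    its image need not even meet [A]. *)
Lemma chained_retraction (e : T -> T -> Prop) (A : set T) n (rho : T -> T) x y :
  piece_retraction n rho ->
  chained (fun u v => same_piece u v /\ e u v) A x y ->
  rho x = rho y \/ chained e (X n `&` A) (rho x) (rho y).
Proof.
move=> [rhoX rhoC]; elim=> [u Au|u v w Au [[m [Nm Xu Xv]] euv] vw IH].
  by left.
have [mn|mn] := eqVneq m n; last by rewrite (rhoC m u v).
right; have [Av _] := chained_endpoints vw.
subst m; rewrite (rhoX u)//; apply: (@chained_step _ _ _ _ v) => //.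
case: IH => [<-|]; rewrite (rhoX v)//.
exact: chained_refl.
Qed.

(** Shortest among all decomposition paths from [x] to [y], which is stronger
    than minimality. *)
Definition shortest_path x y (z : seq T) : Prop :=
  decomposition_path N X x y z /\
  forall z', decomposition_path N X x y z' -> (size z <= size z')%N.

Lemma exists_shortest_path x y z : decomposition_path N X x y z ->
  exists z', shortest_path x y z'.
Proof.
move=> zP; have exP : exists k,
    `[< exists z', size z' = k /\ decomposition_path N X x y z' >].
  by exists (size z); apply/asboolP; exists z.
case: (ex_minnP exP) => k /asboolP[z' [zk z'P]] kmin.
exists z'; split=> // z'' z''P.
by rewrite zk; apply: kmin; apply/asboolP; exists z''.
Qed.

Lemma shortest_path_minimal x y z : shortest_path x y z ->
  minimal_decomposition_path N X x y z.
Proof.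
move=> [zP zmin]; split=> // z' _; rewrite ltnNge => /negP H z'P; apply: H.
exact: zmin.
Qed.

(** If two points of a path lie in a common piece, the part between them may be
    cut out. *)
Lemma shortest_path_shortcut x y z n i j : shortest_path x y z -> N n ->
  (i < j)%N -> (j < size z)%N -> X n (nth x z i) -> X n (nth x z j) -> j = i.+1.
Proof.
move=> [[z0 zx zy zb ze] zmin] Nn ij jz Xi Xj.
apply/eqP; rewrite eqn_leq ij andbT leqNgt.
apply/negP => ij1; pose z' := take i.+1 z ++ drop j z.
have iz : (i.+1 <= size z)%N by lia.
have sz' : size z' = (i.+1 + (size z - j))%N.
  by rewrite size_cat size_drop size_takel.
have nz' k : nth x z' k =
    if (k <= i)%N then nth x z k else nth x z (j + (k - i.+1)).
  rewrite nth_cat size_takel// ltnS; case: leqP => ki; first by rewrite nth_take.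
  by rewrite nth_drop.
have /zmin : decomposition_path N X x y z'; last by rewrite sz'; lia.
split.
- by rewrite sz'.
- by rewrite nz'.
- by rewrite nz' sz' ifF; [rewrite -zy; congr nth; lia|lia].
- move=> k k1; rewrite sz' nz' => kz; case: leqP => ki; apply: zb; lia.
- move=> k k1; rewrite sz' !nz' => kz; case: (leqP k i) => ki.
    by rewrite ifT; [apply: ze; lia|lia].
  have [kE|kE] := eqVneq k i.+1.
    by exists n; rewrite kE /= leqnn subnn addn0.
  rewrite ifF; last by lia.
  have -> : (j + (k.-1 - i.+1) = (j + (k - i.+1)).-1)%N by lia.
  by apply: ze; lia.
Qed.

(** By the absence of shortcuts only the step from [i] to [i.+1] of the path
    lies in [X n], so [rho] is constant along the rest on both sides. *)
Lemma shortest_path_retraction x y z n i (rho : T -> T) :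
  piece_retraction n rho ->
  shortest_path x y z -> N n -> (i.+1 < size z)%N ->
  X n (nth x z i) -> X n (nth x z i.+1) ->
  rho x = nth x z i /\ rho y = nth x z i.+1.
Proof.
move=> [rhoX rhoC] zS Nn iz Xi Xi1.
have [[z0 zx zy zb ze] _] := zS.
have rho_step k : (k.+1 < size z)%N -> k != i ->
    rho (nth x z k) = rho (nth x z k.+1).
  move=> kz ki; have [//||m [Nm Xk Xk1]] := ze k.+1; first by lia.
  have [mn|mn] := eqVneq m n; last exact: rhoC Nm mn Xk Xk1.
  subst m; have [ik|ik] := ltnP i k.
    by have := shortest_path_shortcut zS Nn (leqW ik) kz Xi Xk1; lia.
  have ki1 : (k < i.+1)%N by [].
  by have := shortest_path_shortcut zS Nn ki1 iz Xk Xi1; lia.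
split.
  rewrite -{1}zx -(rhoX _ Xi).
  suff H k : (k <= i)%N -> rho (nth x z 0) = rho (nth x z k) by exact: H.
  elim: k => // k IH ki; rewrite IH; last by lia.
  by apply: rho_step; lia.
rewrite -{1}zy -(rhoX _ Xi1).
suff H k : (i < k < size z)%N -> rho (nth x z k) = rho (nth x z i.+1).
  by apply: H; lia.
elim: k => // k IH /andP[ik kz].
have [<- //|ki] := eqVneq i k.
by rewrite -rho_step ?IH//; lia.
Qed.

End TreeLike.

(** * Maps that are Lipschitz light on each piece *)

Section Gluing.
Variables (R : realType) (T U : metricType R) (N : set nat) (X : nat -> set T).
Variables (C : R) (f : T -> U) (L Q : R).
Hypotheses (C1 : 1 <= C) (X_geom : C_geometric N X C).
Hypothesis f_light : forall n, N n -> lipschitz_light_on L Q (X n) f.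

Let C0 : 0 < C := lt_le_trans ltr01 C1.

Lemma geometric_path x y : exists z : seq T,
  decomposition_path N X x y z /\
  \sum_(i < (size z).-1) mdist (nth x z i) (nth x z i.+1) <= C * mdist x y.
Proof.
have [_ _ /(_ x y)[z zP]] := X_geom; rewrite mulrC ler_pdivrMr// mulrC => zC.
by exists z.
Qed.

Lemma glued_lipschitz x y : mdist (f x) (f y) <= L * C * mdist x y.
Proof.
have [X_tree _ _] := X_geom.
have [L0 _ _ _] := f_light (index_set0 X_tree).
have [z [[z0 zx zy zb ze] zC]] := geometric_path x y.
apply: (@le_trans _ _ (\sum_(i < (size z).-1)
    mdist (f (nth x z i)) (f (nth x z i.+1)))).
  by have := mdist_le_sum (f \o nth x z) (size z).-1; rewrite /= zx zy.
rewrite -mulrA; apply: le_trans (ler_wpM2l (ltW L0) zC).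
rewrite mulr_sumr; apply: ler_sum => i _.
have [//||n [Nn Xi Xi1]] := ze i.+1; first by [].
by have [_ _ fL _] := f_light Nn; exact: fL.
Qed.

(** All points of a path of length at most [D] are within [D] of its origin, and
    its steps are no longer than [D]. *)
Lemma refine_step (D : R) x y : C * mdist x y <= D ->
  chained (fun u v => same_piece N X u v /\ dist_le D u v)
    [set w | mdist x w <= D] x y.
Proof.
move=> xyD; have [z [[z0 zx zy zb ze] zC]] := geometric_path x y.
have sumD k : (k <= (size z).-1)%N ->
    \sum_(i < k) mdist (nth x z i) (nth x z i.+1) <= D.
  move=> kz; apply: le_trans xyD; apply: le_trans zC.
  rewrite -(subnKC kz) big_split_ord /= lerDl.
  by apply: sumr_ge0 => i _; exact: mdist_ge0.
have := @chained_seq T _ _ (nth x z) (size z).-1; rewrite zx zy; apply=> k kz /=.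
  rewrite -{1}zx; apply: le_trans (sumD _ kz).
  exact: (mdist_le_sum (nth x z)).
split; first exact: (ze k.+1).
apply: le_trans (sumD _ kz); rewrite big_ord_recr /= lerDr.
by apply: sumr_ge0 => i _; exact: mdist_ge0.
Qed.

Lemma refine_chain (A : set T) r x y : 0 <= r -> chained (dist_le r) A x y ->
  chained (fun u v => same_piece N X u v /\ dist_le (C * r) u v)
    [set w | exists2 u, A u & mdist u w <= C * r] x y.
Proof.
move=> r0; elim=> [u Au|u v w Au uv _].
  by apply: chained_refl; exists u => //; rewrite mdistxx mulr_ge0// ltW.
have uvr : C * mdist u v <= C * r by rewrite ler_pM2l.
apply: chained_trans; apply: sub_chained (refine_step uvr) => // t ut.
by exists u.
Qed.

Lemma glued_lipschitz_light : lipschitz_light f.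
Proof.
have [X_tree X_min _] := X_geom.
have [L0 Q0 _ _] := f_light (index_set0 X_tree).
(* The refined chain has steps at most [C * r] and stays in the preimage of the
   [L * C * (C * r)]-neighbourhood of [E], of diameter at most
   [r + 2 * (L * C * (C * r))]; the scale [kappa * r] exceeds both. *)
pose kappa := C + 1 + 2 * L * C * C.
have k0 : 0 < kappa by rewrite /kappa !addr_gt0// ?mulr_gt0.
exists (L * C), (C * (Q * kappa)); apply/lipschitz_light_onP.
split=> [||x y _ _|r E r0 Er x y xy]; rewrite ?mulr_gt0//.
  exact: glued_lipschitz.
pose E' := [set v | exists2 u, E u & mdist u v <= L * C * (C * r)].
have kr0 : 0 < kappa * r by exact: mulr_gt0.
have E'kr : (diam E' <= (kappa * r)%:E)%E.
  apply: diam_le (ltW kr0) _ => v1 v2 [u1 Eu1 uv1] [u2 Eu2 uv2].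
  have u12 := mdist_le_diam Er Eu1 Eu2.
  have t1 := metric_triangle v1 u1 v2; have t2 := metric_triangle u1 u2 v2.
  rewrite metric_sym in uv1.
  have Cr0 : 0 < C * r by exact: mulr_gt0.
  rewrite /kappa.
  have -> : (C + 1 + 2 * L * C * C) * r = C * r + r + 2 * (L * C * (C * r)).
    by rewrite !mulrDl mul1r !mulrA.
  lra.
have [z0 [z0P _]] := geometric_path x y.
have [z zS] := exists_shortest_path z0P.
rewrite -!mulrA; apply: le_trans (X_min _ _ _ (shortest_path_minimal zS)) _.
rewrite ler_pM2l//; apply: bigmax_le => [|i _]; first by rewrite !mulr_ge0// ltW.
have [[z_gt0 zx zy zb ze] _] := zS.
have [//||n [Nn Xi Xi1]] := ze i.+1; first by [].
have [p pP] := exists_attaching_points X_tree x.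
have [rho rhoP] := tree_like_retraction X_tree pP Nn.
have iz : (i.+1 < size z)%N by have := ltn_ord i; lia.
have [<- <-] := shortest_path_retraction rhoP zS Nn iz Xi Xi1.
have [->|xy'] := chained_retraction rhoP (refine_chain (ltW r0) xy).
  by rewrite mdistxx !mulr_ge0// ltW.
have /lipschitz_light_onP[_ _ _ fQ] := f_light Nn.
apply: (fQ _ _ kr0 E'kr); apply: sub_chained xy'.
  move=> w [Xw [u [_ Eu] uw]]; split=> //; exists (f u) => //.
  apply: le_trans (glued_lipschitz _ _) _.
  by rewrite ler_wpM2l// ltW// mulr_gt0.
move=> u v /le_trans; apply; rewrite ler_pM2r// /kappa.
by rewrite -addrA lerDl addr_ge0// ltW// !mulr_gt0.
Qed.

End Gluing.

(** * Gluing by translations *)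

Section Euclidean.
Variables (R : realType) (d : nat).

Lemma euclidean_translation (a b : 'rV[R]_d) (u v : euclidean R d) :
  mdist (u - a + b : euclidean R d) (v - a + b : euclidean R d) = mdist u v.
Proof.
congr Num.sqrt; apply: eq_bigr => i _; congr (_ ^+ 2).
by rewrite !mxE; lra.
Qed.

End Euclidean.

Theorem theorem6 (R : realType) (d : nat) (d_ge1 : (1 <= d)%N)
    (T : metricType R) (N : set nat) (X : nat -> set T)
    (X_geometric : geometric N X)
    (f_light : exists (f : nat -> T -> euclidean R d) (L Q : R),
       forall n, N n -> lipschitz_light_on L Q (X n) (f n)) :
  lipschitz_dim_le T d.
Proof.
have [C C1 X_geom] := X_geometric; have [X_tree _ _] := X_geom.
have [f [L [Q fLQ]]] := f_light.
(* A point is needed only to choose the [p n]; an empty space equals [X 0]. *)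
have [[x0 _]|T0] := pselect (exists x : T, True); last first.
  exists (f 0%N); exists L, Q; have -> : [set: T] = X 0%N.
    by apply/seteqP; split=> x; case: T0; exists x.
  by apply: fLQ; exact: index_set0 X_tree.
have [p pP] := exists_attaching_points X_tree x0.
pose h n (y : 'rV[R]_d) x : 'rV[R]_d := (f n x : 'rV[R]_d) - f n (p n) + y.
have hp n y : N n -> n != 0%N -> h n y (p n) = y by rewrite /h subrr add0r.
have [g [g0 gS]] := tree_like_recursion X_tree pP (f 0%N : T -> 'rV[R]_d) hp.
exists g; apply: (glued_lipschitz_light (L := L) (Q := Q) C1 X_geom) => n Nn.
have [n0|n0] := eqVneq n 0%N.
  apply: (lipschitz_light_on_isometry (phi := id)) (fLQ n Nn) => // x.
  by rewrite n0; exact: g0.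
apply: lipschitz_light_on_isometry (fLQ n Nn).
  exact: (euclidean_translation (f n (p n)) (g (p n))).
by move=> x; exact: gS.
Qed.
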